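(* For a feedforward ReLU network with weights $w$, the diagonal natural gradient update $$w_e^{(t+1)}=w_e^{(t)}-\frac{\eta}{F(w^{(t)})[e,e]}\frac{\partial L}{\partial w_e}(w^{(t)}),\qquad F(w)[e,e]=\mathbb E_{X\sim p(X)}\Big[\sum_{v'\in V_{\rm out}}\Big(\frac{\partial f_w(X)[v']}{\partial w_e}\Big)^2\Big],$$ is equivalent to (i.e. is the same update as) DDP-SGD, $$w^{(t+1)}_e=w^{(t)}_e-\frac{\eta}{\kappa_e(w^{(t)})}\frac{\partial L}{\partial w_e}(w^{(t)}),\qquad\kappa_e(w)=\frac12\frac{\partial^2\gamma^2_{\rm net}(w)}{\partial w_e^2},$$ for the choice $R_v=\mathbb E\big[h_{N^{\rm in}(v)}h_{N^{\rm in}(v)}^\top\big]$; that is, $\kappa_e(w)=F(w)[e,e]$ for every edge $e$.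
   Context: Network: a directed acyclic graph $G=(V,E)$ with input nodes $V_{\rm in}$ and output nodes $V_{\rm out}$, edge weights $w_{u\to v}$ (no weight sharing). For a non-input node $v$, $N^{\rm in}(v)$ is the set of nodes feeding into $v$, $h_{N^{\rm in}(v)}$ the vector of their outputs, $w_{\to v}$ the vector of incoming weights, and $z_v=\langle w_{\to v},h_{N^{\rm in}(v)}\rangle$; $h_v=\max(z_v,0)$ for internal nodes, $h_v$ is the corresponding input coordinate for input nodes, and $f_w(X)[v]=z_v$ for output nodes. Expectations are over the input distribution $p(X)$. Complexity measure: for positive semidefinite matrices $R_v$, $\gamma_v^2(w)=w_{\to v}^\top R_vw_{\to v}$ and $\gamma^2_{\rm net}(w)=\sum_{v\in V_{\rm out}}\gamma_v^2(w)$. With $R_v=\mathbb E[h_{N^{\rm in}(v)}h_{N^{\rm in}(v)}^\top]$ one has $\gamma_v^2(w)=\mathbb E[z_v^2]$. $F(w)$ is the Fisher information matrix of the conditional model $Y|X\sim\mathcal N(f_w(X),I)$. $L$ is the training objective and $\eta$ the step size. Convention: when differentiating with respect to $w$, differentiation is taken under the expectation and the activation pattern of the ReLU units at each input is treated as locally constant in $w$ (no pre-activation is exactly at zero). *)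

(* Defs.v *)
From HB Require Import structures.
From mathcomp Require Import all_boot all_order all_algebra.
From mathcomp Require Import all_classical all_reals all_analysis.

Set Implicit Arguments.
Unset Strict Implicit.
Unset Printing Implicit Defensive.

Import Order.TTheory GRing.Theory Num.Theory.
Import numFieldNormedType.Exports.

Local Open Scope classical_set_scope.
Local Open Scope ring_scope.

Record network := Network {
  node : finType;
  arc : rel node;
  inputs : {set node};
  outputs : {set node};
  arc_acyclic : forall u s, ~~ cycle arc (u :: s)
}.

Definition edge (G : network) : finType := {a : node G * node G | arc a.1 a.2}.

Section Network.
Variables (R : realType) (G : network).
Implicit Types (e : edge G) (v : node G).

Definition src e : node G := (val e).1.
Definition tgt e : node G := (val e).2.

(* The graph is simple, so the edges into v are in bijection with N^in(v); they
   index the vectors h_{N^in(v)} and w_{-> v} and the matrix R_v below. *)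
Definition in_edges v : {set edge G} := [set e | tgt e == v].

Definition weights := edge G -> R.

Definition w_in (w : weights) v : 'cV[R]_#|in_edges v| :=
  \col_i w (enum_val i).

Definition h_in (h : node G -> R) v : 'cV[R]_#|in_edges v| :=
  \col_i h (src (enum_val i)).

Definition preact (w : weights) (h : node G -> R) v : R :=
  ((w_in w v)^T *m h_in h v) 0 0.

(* Recursion along the acyclic graph by fuel; paths have at most #|node G|
   nodes, so with that much fuel the recursion equation holds at every node
   (lemma outE). An input vector is a function on all the nodes of which only
   the values at input nodes are read. *)
Fixpoint eval (n : nat) (act : node G -> R -> R) (w : weights)
    (x : node G -> R) v : R :=
  if n is n'.+1 then
    if v \in inputs G then x v else act v (preact w (eval n' act w x) v)
  else 0.

Definition out := eval #|node G|.

Definition zval act (w : weights) (x : node G -> R) v : R :=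
  preact w (out act w x) v.

Definition relu v (z : R) : R := if v \in outputs G then z else Num.max z 0.

Definition net (w : weights) (x : node G -> R) v : R := zval relu w x v.

Definition pattern (w : weights) (x : node G -> R) v : bool :=
  0 < zval relu w x v.

(* The linear units obtained by freezing the activation pattern to a. *)
Definition gate (a : node G -> bool) v (z : R) : R :=
  if v \in outputs G then z else if a v then z else 0.

(* Holds when no pre-activation of an internal node is exactly zero (lemma
   nonzero_locally_constant), but also allows units all of whose predecessors
   are inactive, whose pre-activation is zero for all weights near w. *)
Definition pattern_locally_constant (w : weights) (x : node G -> R) : Prop :=
  exists2 r : R, 0 < r &
    forall w' : weights, (forall e, `|w' e - w e| < r) ->
    forall v, v \notin inputs G -> v \notin outputs G ->
    pattern w' x v = pattern w x v.

Definition partial e (f : weights -> R) (w : weights) : R :=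
  derive1 (fun t : R => f [eta w with e |-> t]) (w e).

Definition gamma2 (Rm : forall v, 'M[R]_#|in_edges v|) (w : weights) v : R :=
  ((w_in w v)^T *m Rm v *m w_in w v) 0 0.

Definition gamma2_net (Rm : forall v, 'M[R]_#|in_edges v|) (w : weights) : R :=
  \sum_(v in outputs G) gamma2 Rm w v.

(* Expectation of g(Y) for Y ~ N(m, I) with coordinates in s, as an iterated
   integral; the coordinates of Y outside s are set to 0. *)
Fixpoint normal_expect (s : seq (node G)) (m : node G -> R)
    (g : (node G -> R) -> R) : R :=
  if s is v :: s' then
    (\int[normal_prob (m v) 1]_t
       normal_expect s' m (fun y => g [eta y with v |-> t]))%R
  else g (fun=> 0).

(* log p(y | x) for the model Y | X ~ N(f_w(X), I). *)
Definition log_lik (w : weights) (x y : node G -> R) : R :=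
  ln (\prod_(v in outputs G) normal_pdf (net w x v) 1 (y v)).

Section Distribution.
Context d (T : measurableType d) (P : probability T R).
Variable X : node G -> {RV P >-> R}.

Definition sample (o : T) : node G -> R := fun v => X v o.

(* R_v = E[h h^T]; the activation functions may depend on the sample. *)
Definition R_data (act : T -> node G -> R -> R) (w : weights) v :
    'M[R]_#|in_edges v| :=
  \matrix_(i, j) fine ('E_P[(fun o =>
    let h := h_in (out (act o) w (sample o)) v in (h *m h^T) i j)%R])%E.

Definition gamma2_net_data (w : weights) : R :=
  gamma2_net (R_data (fun=> relu) w) w.

(* The function w |-> gamma^2_net(w), R_v depending on w, with the activation
   pattern at each input held fixed at its value for w0: this is the function
   to differentiate at w0. It coincides with gamma2_net_data at w = w0 (lemma
   gamma2_net_frozenE), and its units coincide with the ReLU units wherever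
   the activation pattern is the one at w0 (lemma out_gate). *)
Definition gamma2_net_frozen (w0 w : weights) : R :=
  gamma2_net (R_data (fun o => gate (pattern w0 (sample o))) w) w.

Definition kappa (w : weights) e : R :=
  2^-1 * partial e (partial e (gamma2_net_frozen w)) w.

Definition fisher (w : weights) e e' : R :=
  fine ('E_P[(fun o => normal_expect (enum (outputs G)) (net w (sample o))
    (fun y => partial e (fun w' => log_lik w' (sample o) y) w *
              partial e' (fun w' => log_lik w' (sample o) y) w))%R])%E.

Definition diag_natural_gradient_step (eta : R) (L : weights -> R)
    (w : weights) : weights :=
  fun e => w e - eta / fisher w e e * partial e L w.

Definition ddp_sgd_step (eta : R) (L : weights -> R) (w : weights) : weights :=
  fun e => w e - eta / kappa w e * partial e L w.

End Distribution.

End Network.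

Section Facts.
Variables (R : realType) (G : network).
Implicit Types (e : edge G) (v : node G) (w : weights R G) (x : node G -> R).

Lemma preactE w (h : node G -> R) v :
  preact w h v = \sum_(e in in_edges v) w e * h (src e).
Proof.
rewrite /preact mxE [RHS]big_enum_val /=; apply: eq_bigr => i _.
by rewrite !mxE.
Qed.

Lemma acyclic_path_uniq (u : node G) p : path (@arc G) u p -> uniq (u :: p).
Proof.
elim: p u => [//|v p IHp] u uvp.
have /andP[uv vp] := uvp.
rewrite cons_uniq (IHp _ vp) andbT; apply/negP => uin.
case/splitPr: uin uvp => p1 p2; rewrite cat_path /= => /and3P[up1 p1u _].
by have /negP := arc_acyclic u p1; apply; rewrite /= rcons_path up1.
Qed.

Lemma eval_neq n act w x v : eval n.+1 act w x v != eval n act w x v ->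
  exists u p, [/\ path (@arc G) u p, last u p = v & size p = n].
Proof.
elim: n v => [|n IHn] v; first by exists v, [::].
rewrite /=; case: ifP => _; first by rewrite eqxx.
move=> neq.
have [e /[!inE] /eqP ev neqe] : exists2 e, e \in in_edges v &
    eval n.+1 act w x (src e) != eval n act w x (src e).
  apply/exists_inP; apply: contraNT neq; rewrite negb_exists_in => /forall_inP eqe.
  apply/eqP; congr (act v _); rewrite !preactE; apply: eq_bigr => e ev.
  by congr (_ * _); apply/eqP; have := eqe _ ev; rewrite negbK.
have [u [p [up lp sp]]] := IHn _ neqe.
exists u, (rcons p v); rewrite rcons_path last_rcons size_rcons sp up lp -ev.
by split=> //; exact: (valP e).
Qed.

Lemma outE act w x v :
  out act w x v = if v \in inputs G then x v else act v (zval act w x v).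
Proof.
rewrite -[RHS]/(eval #|node G|.+1 act w x v) /out.
apply/esym/eqP/negPn/negP => /eval_neq[u [p [/acyclic_path_uniq + _ sp]]].
by move=> /card_uniqP upE; have := max_card (mem (u :: p)); rewrite upE /= sp ltnn.
Qed.

Lemma out_unique act w x (h : node G -> R) :
  (forall v, h v = if v \in inputs G then x v else act v (preact w h v)) ->
  h = out act w x.
Proof.
move=> hE; apply/funext => v; apply: contrapT => /eqP neq.
suff H n : forall v, h v != out act w x v ->
    exists u p, [/\ path (@arc G) u p, last u p = v & size p = n].
  have [u [p [/acyclic_path_uniq + _ sp]]] := H #|node G| _ neq.
  move=> /card_uniqP upE; have := max_card (mem (u :: p)).
  by rewrite upE /= sp ltnn.
elim: n {v neq} => [|n IHn] v neq; first by exists v, [::].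
move: neq; rewrite hE outE; case: ifP => _; first by rewrite eqxx.
move=> neq.
have [e /[!inE] /eqP ev neqe] : exists2 e, e \in in_edges v &
    h (src e) != out act w x (src e).
  apply/exists_inP; apply: contraNT neq; rewrite negb_exists_in => /forall_inP eqe.
  apply/eqP; congr (act v _); rewrite /zval !preactE; apply: eq_bigr => e ev.
  by congr (_ * _); apply/eqP; have := eqe _ ev; rewrite negbK.
have [u [p [up lp sp]]] := IHn _ neqe.
exists u, (rcons p v); rewrite rcons_path last_rcons size_rcons sp up lp -ev.
by split=> //; exact: (valP e).
Qed.

Lemma out_gate (a : node G -> bool) w x :
  (forall v, v \notin inputs G -> v \notin outputs G -> pattern w x v = a v) ->
  out (gate a) w x = out (@relu R G) w x.
Proof.
move=> pa; apply/esym/out_unique => v; rewrite outE; case: ifP => // /negbT vi.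
rewrite /relu /gate; case: ifP => // /negbT vo.
rewrite -pa// /pattern /zval; set z := preact _ _ _.
by case: (ltP 0 z).
Qed.

Lemma gamma2_net_frozenE d (T : measurableType d) (P : probability T R)
    (X : node G -> {RV P >-> R}) w :
  gamma2_net_frozen X w w = gamma2_net_data X w.
Proof.
rewrite /gamma2_net_frozen /gamma2_net_data; congr gamma2_net.
apply/functional_extensionality_dep => v; apply/matrixP => i j.
rewrite !mxE; congr fine; congr expectation.
by apply/funext => o; rewrite out_gate.
Qed.

Definition near_weights w : set_system (weights R G) :=
  [set A | exists2 r : R, 0 < r &
     forall w', (forall e, `|w' e - w e| < r) -> A w'].

Instance near_weights_filter w : ProperFilter (near_weights w).
Proof.
apply: Build_ProperFilter_ex => [A [r r0 Ar]|].
  by exists w; apply: Ar => e; rewrite subrr normr0.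
split=> [|A B [r r0 Ar] [s s0 Bs]|A B AB [r r0 Ar]].
- by exists 1.
- exists (Num.min r s) => [|w' w'P]; first by rewrite lt_min r0.
  by split; [apply: Ar|apply: Bs] => e; have := w'P e; rewrite lt_min => /andP[].
- by exists r => // w' w'P; apply/AB/Ar.
Qed.

Lemma preact_cvg w (h : weights R G -> node G -> R) v :
  (forall u, h w' u @[w' --> near_weights w] --> h w u) ->
  preact w' (h w') v @[w' --> near_weights w] --> preact w (h w) v.
Proof.
move=> hc; rewrite preactE (_ : (fun w' => _) =
    fun w' => \sum_(e in in_edges v) w' e * h w' (src e)).
  apply: (@cvg_big R^o _ _ 0 _ (@add_continuous R^o) _ _ _
    (fun e w' => w' e * h w' (src e)) (fun e => w e * h w (src e))) => e _.
  apply: cvgM => //.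
  apply/cvgrPdist_lt => r r0; exists r => // w' w'P.
  by rewrite distrC; exact: w'P.
by apply/funext => w'; rewrite preactE.
Qed.

Lemma eval_cvg w x n v :
  eval n (@relu R G) w' x v @[w' --> near_weights w] -->
  eval n (@relu R G) w x v.
Proof.
elim: n v => [|n IHn] v /=; first exact: cvg_cst.
case: ifP => _; first exact: cvg_cst.
have zc := @preact_cvg w (fun w' => eval n (@relu R G) w' x) v IHn.
have relu_cont : continuous (@relu R G v).
  move=> z; rewrite /relu; case: (v \in outputs G); first exact: cvg_id.
  by apply: (@continuous_max _ _ id (cst 0)); [exact: cvg_id|exact: cvg_cst].
exact: continuous_cvg (relu_cont _) zc.
Qed.

Lemma nonzero_locally_constant w x :
  (forall v, v \notin inputs G -> v \notin outputs G ->
     zval (@relu R G) w x v != 0) ->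
  pattern_locally_constant w x.
Proof.
move=> z_neq0; suff [r r0 rP] : \forall w' \near near_weights w, forall v,
    v \notin inputs G -> v \notin outputs G -> pattern w' x v = pattern w x v.
  by exists r.
apply: filter_forall => v.
have zc : zval (@relu R G) w' x v @[w' --> near_weights w] -->
          zval (@relu R G) w x v.
  apply: (@preact_cvg w (fun w' => out (@relu R G) w' x)) => u.
  exact: eval_cvg.
have [vi|vi] := boolP (v \in inputs G); first by apply: nearW.
have [vo|vo] := boolP (v \in outputs G); first by apply: nearW.
rewrite /pattern; have := z_neq0 v vi vo; rewrite neq_lt => /orP[z0|z0].
  apply: (filterS _ (cvgr_lt _ zc _ z0)) => w' /= w'0 _ _.
  by rewrite (lt_gtF z0) (lt_gtF w'0).
apply: (filterS _ (cvgr_gt _ zc _ z0)) => w' /= w'0 _ _.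
by rewrite z0 w'0.
Qed.

End Facts.

(* Main.v *)
(* Freeze the activation pattern of each sample x at w. The resulting network is
   linear in its activations and, the graph being acyclic, affine in each single
   weight: z_v = a_v(x) + t b_v(x) when w_e = t, with a_v and b_v square
   integrable. Hence gamma_net^2 is a quadratic polynomial in t with leading
   coefficient sum_v E[b_v^2], which is kappa_e. For almost every x the ReLU
   network agrees with the frozen one for t near w_e, so that
   d f_w(x)[v] / d w_e = b_v(x), and the score of the Gaussian model is
   sum_v b_v(x) (y_v - f_w(x)[v]); as the coordinates of y are independent with
   unit variance, the conditional expectation of its square is sum_v b_v(x)^2. *)

Require Import Defs.
From HB Require Import structures.
From mathcomp Require Import all_boot all_order all_algebra.
From mathcomp Require Import all_classical all_reals all_analysis measurable_realfun.
From mathcomp Require Import ring lra.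

Set Implicit Arguments.
Unset Strict Implicit.
Unset Printing Implicit Defensive.

Import Order.TTheory GRing.Theory Num.Theory.
Import numFieldNormedType.Exports.

Local Open Scope classical_set_scope.
Local Open Scope ring_scope.

(** * Integrals of nonnegative functions equal almost everywhere *)

Section AlmostEverywhere.
Context d (T : measurableType d) (R : realType).
Variable mu : {measure set T -> \bar R}.
Local Open Scope ereal_scope.
Import HBNNSimple.

(* [f] and [g] need not be measurable: a simple function below [f] stays below
   [g] after it is set to zero on the exceptional null set. *)
Lemma ae_le_ge0_integral (f g : T -> \bar R) :
    (forall x, 0 <= f x) -> (forall x, 0 <= g x) ->
    {ae mu, forall x, f x <= g x} ->
  \int[mu]_x f x <= \int[mu]_x g x.
Proof.
move=> f0 g0 [N [mN muN0 fgN]].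
rewrite [leLHS]ge0_integralTE// [leRHS]ge0_integralTE//.
apply: ge_ereal_sup => _ [h /= hf <-].
have mNC : measurable (~` N) by exact: measurableC.
pose h' := mul_nnsfun h (indic_nnsfun R mNC).
have h'E x : h' x = (h x * \1_(~` N) x)%R by [].
have -> : sintegral mu h = sintegral mu h'.
  rewrite -!integralT_nnsfun; apply: ae_eq_integral => //.
  - exact/measurable_EFinP.
  - exact/measurable_EFinP.
  - exists N; split => // x /= xN; apply: contrapT => Nx; apply: xN => _.
    by congr EFin; apply: etrans (esym (h'E x)); rewrite indicE mem_set// mulr1.
apply: ereal_sup_ubound; exists h' => // x; rewrite h'E indicE.
have [/[!inE] Nx|_] := boolP (x \in ~` N); last by rewrite mulr0.
rewrite mulr1 (le_trans (hf x))//; apply: contrapT => fg; apply: Nx.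
exact: fgN.
Qed.

(** This is needed for integrands built from [partial] and [normal_expect], whose measurability in
    the sample is not established. *)
Lemma ae_eq_ge0_integral (f g : T -> \bar R) :
    (forall x, 0 <= f x) -> (forall x, 0 <= g x) ->
    {ae mu, forall x, f x = g x} ->
  \int[mu]_x f x = \int[mu]_x g x.
Proof.
move=> f0 g0 fg; apply/eqP; rewrite eq_le !ae_le_ge0_integral//.
- by apply: filterS fg => x ->.
- by apply: filterS fg => x ->.
Qed.

End AlmostEverywhere.

(** * Moments of order at most two of a Gaussian with unit variance *)

Section GaussianMoments.
Variable R : realType.
Notation mu := (@lebesgue_measure R).

Lemma cvg_integral_centered_itv (f : R -> R) (m : R) :
  mu.-integrable [set: R] (EFin \o f) ->
  (\int[mu]_(x in `[(m - n%:R)%R, (m + n%:R)%R]) (f x)%:E @[n --> \oo] -->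
   \int[mu]_x (f x)%:E)%E.
Proof.
move=> fi; have /measurable_int mf := fi.
under eq_fun do rewrite integral_mkcond.
have [] := @dominated_convergence _ _ _ mu setT measurableT
    (fun n : nat => (EFin \o f) \_ `[m - n%:R, m + n%:R]) (EFin \o f)
    (abse \o (EFin \o f)) => //.
- by move=> n; apply/(measurable_restrictT _ _).1 => //; exact: measurable_funTS.
- apply: aeW => x _; apply: cvg_near_cst.
  near=> n; rewrite patchE mem_set//= in_itv/=.
  have /andP[] : - n%:R <= x - m <= n%:R.
    by rewrite -ler_norml; near: n; exact: nbhs_infty_ger.
  by move=> ? ?; apply/andP; split; lra.
- exact: integrable_abse.
- apply: aeW => x n _; rewrite patchE; case: ifP => //= _.
  by rewrite normr0 lee_fin.
Unshelve. all: end_near. Qed.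

(** The fundamental theorem of calculus on [[m - n, m + n]], followed by dominated convergence.
    Centering at [m] lets parity about [m] simplify the boundary terms. *)
Lemma integral_derive_centered (f F : R -> R) (m l : R) :
  mu.-integrable [set: R] (EFin \o f) -> continuous f ->
  (forall x : R, is_derive x 1 F (f x)) ->
  (F (m + n%:R) - F (m - n%:R)) @[n --> \oo] --> l ->
  (\int[mu]_x (f x)%:E = l%:E)%E.
Proof.
move=> fi cf dF Fl.
have Fl' : ((\int[mu]_(x in `[(m - n%:R)%R, (m + n%:R)%R]) (f x)%:E) @[n --> \oo] --> l%:E)%E.
  apply: (@cvg_trans _ ((F (m + n%:R) - F (m - n%:R))%:E @[n --> \oo])); last first.
    by apply: cvg_EFin => //; exact: nearW.
  (* Equality only for large [n]: the interval is degenerate at [n = 0]. *)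
  apply: near_eq_cvg; near=> n.
  have cF x : {for x, continuous F}.
    by apply/differentiable_continuous/derivable1_diffP; have [] := dF x.
  rewrite (@continuous_FTC2 _ f F) ?EFinB//.
  - have n0 : (0 : R) < n%:R by rewrite ltr0n; near: n; exact: nbhs_infty_gt.
    lra.
  - exact: continuous_subspaceT.
  - split=> [x _||]; first by case: (dF x).
    + exact/cvg_at_right_filter/cF.
    + exact/cvg_at_left_filter/cF.
  - by move=> x _; rewrite derive1E; case: (dF x).
rewrite -(cvg_lim (@ereal_hausdorff R) (cvg_integral_centered_itv m fi)).
exact/cvg_lim.
Unshelve. all: end_near. Qed.

(** The Radon-Nikodym derivative and [normal_pdf] have the same integral over every measurable set,
    hence agree almost everywhere. *)
Lemma integral_normal_prob (m s : R) (f : R -> \bar R) :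
    measurable_fun [set: R] f -> (forall x, 0 <= f x)%E ->
  (\int[normal_prob m s]_x f x = \int[mu]_x (f x * (normal_pdf m s x)%:E))%E.
Proof.
move=> mf f0; have dom := normal_prob_dominates m s.
rewrite -(Radon_Nikodym_SigmaFinite.change_of_variables dom)//.
have RNi := Radon_Nikodym_SigmaFinite.f_integrable dom.
have mRN := measurable_int _ RNi.
have mp : measurable_fun [set: R] (EFin \o normal_pdf m s).
  by apply/measurable_EFinP; exact: measurable_normal_pdf.
apply: ae_eq_integral => //; [exact: emeasurable_funM..|].
apply: ae_eqe_mul2l; apply: integral_ae_eq => // A _ mA.
by rewrite -Radon_Nikodym_SigmaFinite.f_integral.
Qed.

Variable m : R.
Notation p := (normal_pdf m 1).

Lemma normal_pdf1E x :
  p x = normal_peak 1 * expR (- ((x - m) ^+ 2 / 2)).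
Proof.
by rewrite /normal_pdf oner_eq0 /normal_fun expr1n mulNr.
Qed.

(* With [y = (x - m)^2], this is [y exp(-y/2) <= 4 exp(-y/4)]. *)
Lemma sqr_normal_pdf1_le x : (x - m) ^+ 2 * p x <=
  4 * normal_peak 1 / normal_peak (Num.sqrt 2) * normal_pdf m (Num.sqrt 2) x.
Proof.
have s2 : Num.sqrt 2 != 0 :> R by rewrite gt_eqF// sqrtr_gt0.
rewrite normal_pdf1E /normal_pdf (negbTE s2) /normal_fun sqr_sqrtr//.
set y := (x - m) ^+ 2.
have -> : - y / (2 *+ 2) = - (y / 4) :> R by rewrite mulNr; congr (- (_ * _^-1)); ring.
have -> : - (y / 2) = - (y / 4) + - (y / 4) :> R by lra.
rewrite expRD.
have e0 : 0 < expR (- (y / 4)) :> R := expR_gt0 _.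
(* Multiply [1 + y / 4 <= expR (y / 4)] by [4 * expR (- (y / 4))]. *)
have : y * expR (- (y / 4)) <= 4.
  have : expR (y / 4) * expR (- (y / 4)) = 1 :> R by rewrite -expRD subrr expR0.
  have := expR_ge1Dx (y / 4); nra.
have pk := normal_peak_gt0 s2.
have pk1 : 0 < normal_peak (1 : R) by rewrite normal_peak_gt0// oner_neq0.
set E := expR _ in e0 *; set K := normal_peak 1 in pk1 *.
set D := normal_peak _ in pk * => yE.
have -> : 4 * K / D * (D * E) = 4 * (K * E) by field; rewrite gt_eqF.
have -> : y * (K * (E * E)) = y * E * (K * E) by ring.
by rewrite ler_wpM2r// mulr_ge0 ?ltW.
Qed.

Lemma integrable_sqr_normal_pdf1 :
  mu.-integrable [set: R] (EFin \o (fun x => (x - m) ^+ 2 * p x)).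
Proof.
pose C := 4 * normal_peak 1 / normal_peak (Num.sqrt 2) : R.
apply: (@le_integrable _ _ _ mu _ measurableT _
    (fun x => C%:E * (normal_pdf m (Num.sqrt 2) x)%:E)%E).
- apply/measurable_EFinP; apply: measurable_funM.
    by apply: measurable_funX; exact: measurable_funB.
  exact: measurable_normal_pdf.
- move=> x _ /=; rewrite lee_fin ger0_norm; last first.
    by apply: mulr_ge0; [exact: sqr_ge0|exact: normal_pdf_ge0].
  exact: le_trans (sqr_normal_pdf1_le x) (ler_norm _).
- exact/(integrableZl measurableT)/integrable_normal_pdf.
Qed.

Lemma integrable_center_normal_pdf1 :
  mu.-integrable [set: R] (EFin \o (fun x => (x - m) * p x)).
Proof.
apply: (@le_integrable _ _ _ mu _ measurableT _
    (fun x => (p x + (x - m) ^+ 2 * p x)%:E)).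
- apply/measurable_EFinP; apply: measurable_funM; first exact: measurable_funB.
  exact: measurable_normal_pdf.
- move=> x _ /=; rewrite lee_fin normrM [`|p x|]ger0_norm ?normal_pdf_ge0//.
  apply: le_trans (ler_norm _).
  (* What remains is [|u| <= 1 + u ^+ 2] with [u = x - m]. *)
  rewrite -[X in _ <= X + _]mul1r -mulrDl ler_wpM2r ?normal_pdf_ge0//.
  rewrite -(real_normK (num_real (x - m))).
  by have := normr_ge0 (x - m); nra.
- under eq_fun do rewrite EFinD.
  apply: (integrableD measurableT); first exact: integrable_normal_pdf.
  exact: integrable_sqr_normal_pdf1.
Qed.

Lemma is_derive_normal_pdf1 (x : R) : is_derive x 1 p (- (x - m) * p x).
Proof.
(* The exponent is presented as a polynomial, so that its derivative is computed algebraically. *)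
pose q : {poly R} := (- 2^-1)%:P * ('X - m%:P) ^+ 2.
have qE z : q.[z] = - ((z - m) ^+ 2 / 2).
  by rewrite /q hornerM hornerC horner_exp hornerXsubC mulNr mulrC.
have q'E : q^`().[x] = - (x - m).
  rewrite /q derivM derivC mul0r add0r expr2 derivM derivXsubC mulr1 mul1r.
  rewrite hornerM hornerC hornerD hornerXsubC; lra.
have -> : p = normal_peak 1 \*: (expR \o horner q).
  by apply/funext => z; rewrite normal_pdf1E /= qE.
apply: is_derive_eq; rewrite /= qE q'E /GRing.scale/=; ring.
Qed.

(** The integrand has primitive [- p], which takes equal values at [m + n] and [m - n]. *)
Lemma integral_center_normal_pdf1 : (\int[mu]_x ((x - m) * p x)%:E = 0)%E.
Proof.
have dp := is_derive_normal_pdf1.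
apply: (@integral_derive_centered _ (- p) m).
- exact: integrable_center_normal_pdf1.
- move=> x; apply: cvgM; last exact/continuous_normal_pdf/oner_neq0.
  by apply: cvgB; [exact: cvg_id|exact: cvg_cst].
- by move=> x; apply: is_derive_eq; rewrite mulNr opprK.
- rewrite (_ : (fun n : nat => _) = cst 0); first exact: cvg_cst.
  apply/funext => n; rewrite !fctE !normal_pdf1E.
  have -> : m - n%:R - m = - (m + n%:R - m) by ring.
  by rewrite sqrrN subrr.
Qed.

(** Integration by parts: [(x - m) * p x] has derivative [p x - (x - m) ^+ 2 * p x] and vanishes at
    infinity, so the second moment equals the total mass. *)
Lemma integral_sqr_normal_pdf1 : (\int[mu]_x ((x - m) ^+ 2 * p x)%:E = 1)%E.
Proof.
have dp := is_derive_normal_pdf1.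
have ip := integrable_normal_pdf m 1.
have isp := integrable_sqr_normal_pdf1.
have : (\int[mu]_x (p x - (x - m) ^+ 2 * p x)%:E = 0)%E.
  apply: (@integral_derive_centered _ (fun x => (x - m) * p x) m).
  - exact: (integrableB measurableT ip isp).
  - have cp := @continuous_normal_pdf R m 1 (oner_neq0 _).
    move=> x; have cx : z - m @[z --> x] --> x - m.
      by apply: cvgB; [exact: cvg_id|exact: cvg_cst].
    exact: (cvgB (cp x) (cvgM (cvgM cx cx) (cp x))).
  - move=> x; apply: is_derive_eq; rewrite /GRing.scale/=; ring.
  - have K0 : 0 <= normal_peak (1 : R) by exact: normal_peak_ge0.
    (* The boundary term is [2 n] times the peak times [E = expR (- (n ^ 2 / 2))]. Since
       [(1 + n ^ 2 / 2) * E <= 1] and [2 n (n + 1) <= 8 (1 + n ^ 2 / 2)], the constant 8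
       suffices. *)
    apply: (@squeeze_cvgr _ _ _ _ (cst 0) (fun n => 8 * normal_peak 1 * harmonic n)).
    + apply: nearW => n /=; rewrite !normal_pdf1E.
      have -> : m + n%:R - m = n%:R by ring.
      have -> : m - n%:R - m = - n%:R by ring.
      rewrite sqrrN mulNr opprK /harmonic/=.
      set E := expR _; have E0 : 0 < E := expR_gt0 _.
      have nE : (1 + n%:R ^+ 2 / 2) * E <= 1.
        rewrite /E expRN ler_pdivrMr ?expR_gt0// mul1r; exact: expR_ge1Dx.
      have : (n%:R + n%:R) * E <= 8 / n.+1%:R.
        rewrite ler_pdivlMr// -natr1.
        by have : 0 <= n%:R :> R by []; nra.
      move=> nE8; apply/andP; split.
        by rewrite addr_ge0// !mulr_ge0// ltW.
      have -> : n%:R * (normal_peak 1 * E) + n%:R * (normal_peak 1 * E) =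
        normal_peak 1 * ((n%:R + n%:R) * E) by ring.
      by rewrite [8 * _]mulrC -mulrA ler_wpM2l.
    + exact: cvg_cst.
    + rewrite -[X in _ --> X](mulr0 (8 * normal_peak 1)).
      by apply: cvgMl_tmp; exact: cvg_harmonic.
have -> : (\int[mu]_x (p x - (x - m) ^+ 2 * p x)%:E =
    \int[mu]_x (p x)%:E - \int[mu]_x ((x - m) ^+ 2 * p x)%:E)%E.
  exact: (integralB measurableT ip isp).
have /fineK <- := integrable_fin_num measurableT isp.
rewrite integral_normal_pdf -EFinB => -[] /eqP; rewrite subr_eq0 => /eqP <-.
by [].
Qed.

(** The centered moments of order 0, 1, 2 are 1, 0, 1. Nonnegativity allows the passage to the
    density through [integral_normal_prob]. *)
Lemma Rintegral_normal_prob_quadratic (a b c : R) :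
  (forall t, 0 <= a + b * (t - m) + c * (t - m) ^+ 2) ->
  \int[normal_prob m 1]_t (a + b * (t - m) + c * (t - m) ^+ 2) = a + c.
Proof.
move=> q0; rewrite /Rintegral integral_normal_prob//; last first.
  apply/measurable_EFinP; apply: measurable_funD.
    apply: measurable_funD => //; apply: measurable_funM => //.
    exact: measurable_funB.
  apply: measurable_funM => //; apply: measurable_funX.
  exact: measurable_funB.
have ip := integrableZl measurableT a (integrable_normal_pdf m 1).
have ic := integrableZl measurableT b integrable_center_normal_pdf1.
have isq := integrableZl measurableT c integrable_sqr_normal_pdf1.
transitivity (fine (\int[mu]_x (a%:E * (p x)%:E + b%:E * ((x - m) * p x)%:E +
    c%:E * ((x - m) ^+ 2 * p x)%:E))%E).
  by congr fine; apply: eq_integral => x _; rewrite -!EFinM -!EFinD; congr EFin; ring.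
rewrite (integralD measurableT (integrableD measurableT ip ic) isq).
rewrite (integralD measurableT ip ic).
rewrite (integralZl measurableT (integrable_normal_pdf m 1)).
rewrite (integralZl measurableT integrable_center_normal_pdf1).
rewrite (integralZl measurableT integrable_sqr_normal_pdf1).
rewrite integral_normal_pdf integral_center_normal_pdf1 integral_sqr_normal_pdf1.
by rewrite !mule1 mule0 adde0.
Qed.

End GaussianMoments.

(** * Closure properties and expectations of square integrable variables *)

Section SquareIntegrable.
Context d (T : measurableType d) (R : realType) (P : probability T R).

Lemma le_Lfun2 (f g : T -> R) : measurable_fun setT f ->
  (forall o, `|f o| <= `|g o|) -> g \in Lfun P 2%:E -> f \in Lfun P 2%:E.
Proof.
move=> mf fg /(Lfun_integrable (ler1n _ 2)) /integrableP[mg ig].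
rewrite inE; apply/andP; split; rewrite inE//=.
rewrite /finite_norm unlock poweR_lty//.
apply: le_lt_trans ig; apply: ge0_le_integral => //=.
- apply/measurable_EFinP; apply: (measurableT_comp (measurable_powR _)) => //.
  exact: measurableT_comp.
- by apply/measurable_EFinP; apply: measurableT_comp => //; exact/measurable_EFinP.
- move=> o _; rewrite lee_fin; apply: le_trans (ler_norm _).
  by apply: ge0_ler_powR => //; rewrite nnegrE.
Qed.

Lemma Lfun2_sum (I : Type) (r : seq I) (Q : pred I) (F : I -> T -> R) :
  (forall i, F i \in Lfun P 2%:E) ->
  (fun o => \sum_(i <- r | Q i) F i o) \in Lfun P 2%:E.
Proof.
move=> F2; have p1 : (1 <= 2%:E :> \bar R)%E by rewrite lee_fin ler1n.
have LD := (Lfun_addr_closed P p1).2.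
elim: r => [|i r IHr].
  by under eq_fun do rewrite big_nil; exact: (Lfun_cst P 0 2).
by under eq_fun do rewrite big_cons; case: (Q i) => //; exact: LD.
Qed.

Lemma Lfun2_scale (k : R) (f : T -> R) :
  f \in Lfun P 2%:E -> (fun o => k * f o) \in Lfun P 2%:E.
Proof.
move=> f2; under eq_fun do rewrite mulrC.
by apply: Lfun_scale => //; rewrite ler1n.
Qed.

(** Integrability is carried along the induction because additivity of the expectation requires it
    of the tail. *)
Lemma fine_expectation_lincomb (I : Type) (r : seq I) (c : I -> R)
    (F : I -> T -> R) : (forall i, F i \in Lfun P 1) ->
  (fun o => \sum_(i <- r) c i * F i o) \in Lfun P 1 /\
  fine 'E_P[(fun o => \sum_(i <- r) c i * F i o)%R] =
  \sum_(i <- r) c i * fine 'E_P[F i].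
Proof.
move=> F1; elim: r => [|i r [IHL IHE]].
  under eq_fun do rewrite big_nil; rewrite big_nil; split.
    exact: (Lfun_cst P 0 1).
  by rewrite expectation_cst.
have iF1 : (fun o => c i * F i o) \in Lfun P 1.
  by under eq_fun do rewrite mulrC; exact: Lfun_scale.
under eq_fun do rewrite big_cons; rewrite big_cons -IHE; split.
  exact: (Lfun_addr_closed P (lexx 1%E)).2.
rewrite (expectationD iF1 IHL) fineD ?expectation_fin_num//; congr (_ + _).
rewrite -[c i]/(fine (c i)%:E) -fineM ?expectation_fin_num// -expectationZl//.
by congr (fine (expectation _ _)); apply/funext => o /=; rewrite mulrC.
Qed.

Lemma fine_expectation_sqr_affine (f g : T -> R) (t : R) :
  f \in Lfun P 2%:E -> g \in Lfun P 2%:E ->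
  fine 'E_P[(fun o => (f o + t * g o) ^+ 2)%R] =
  fine 'E_P[(f \* f)%R] + t * (2 * fine 'E_P[(f \* g)%R]) +
  t ^+ 2 * fine 'E_P[(g \* g)%R].
Proof.
move=> f2 g2.
pose c (i : 'I_3) : R := [:: 1; t * 2; t ^+ 2]`_i.
pose F (i : 'I_3) : T -> R := nth f [:: f \* f; f \* g; g \* g] i.
have F1 i : F i \in Lfun P 1.
  by case: i => -[|[|[|//]]] ? /=; exact: Lfun2_mul_Lfun1.
have [_] := fine_expectation_lincomb (index_enum 'I_3) c F1.
rewrite 3!big_ord_recr big_ord0/= add0r mul1r -mulrA => <-.
congr (fine (expectation _ _)); apply/funext => o.
by rewrite 3!big_ord_recr big_ord0/= /c /F/=; ring.
Qed.

End SquareIntegrable.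

(** * Second moment of an affine form in independent Gaussian coordinates *)

Section NormalExpectation.
Variables (R : realType) (G : network).
Implicit Types (s : seq (node G)) (m c : node G -> R).

Lemma normal_expect_ge0 s m (g : (node G -> R) -> R) :
  (forall y, 0 <= g y) -> 0 <= normal_expect s m g.
Proof.
elim: s g => [|v s IHs] g g0 /=; first exact: g0.
by apply: Rintegral_ge0 => t _; apply: IHs => y; exact: g0.
Qed.

(** The offset [k] is general so that the induction can absorb into it the term [c v * (t - m v)] of
    the coordinate held fixed by the outer integral. Integrating over [t] then kills the cross term
    and leaves [c v ^+ 2]. *)
Lemma normal_expect_sqr s m c (k : R) : uniq s ->
  normal_expect s m (fun y => (k + \sum_(v <- s) c v * (y v - m v)) ^+ 2) =
  k ^+ 2 + \sum_(v <- s) c v ^+ 2.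
Proof.
elim: s k => [|v s IHs] k /=; first by rewrite !big_nil !addr0.
move=> /andP[vs us]; set S := \sum_(u <- s) c u ^+ 2.
have sE t : normal_expect s m (fun y =>
    (k + \sum_(u <- v :: s) c u * ([eta y with v |-> t] u - m u)) ^+ 2) =
    (k ^+ 2 + S) + (2 * k * c v) * (t - m v) + c v ^+ 2 * (t - m v) ^+ 2.
  transitivity (normal_expect s m (fun y =>
      (k + c v * (t - m v) + \sum_(u <- s) c u * (y u - m u)) ^+ 2)).
    (* As [v] does not occur in [s], overriding [y] at [v] leaves the other terms unchanged. *)
    congr normal_expect; apply/funext => y; rewrite big_cons /= eqxx addrA.
    congr ((_ + _) ^+ 2); apply: eq_big_seq => u us'.
    by rewrite ifN//; apply: contraNneq vs => <-.
  rewrite IHs// -/S; ring.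
under eq_Rintegral do rewrite sE.
rewrite Rintegral_normal_prob_quadratic; last first.
  move=> t; rewrite -sE; apply: normal_expect_ge0 => y; exact: sqr_ge0.
by rewrite big_cons -/S -addrA [S + _]addrC.
Qed.

End NormalExpectation.

(** * Dependence of the network and of the log-likelihood on a single weight *)

Section SingleWeight.
Variables (R : realType) (G : network).
Implicit Types (e : edge G) (v : node G) (w : weights R G) (x : node G -> R).

(** Such a path, closed up by [e], would be a cycle. *)
Lemma src_unreachable e : ~~ connect (@Defs.arc G) (tgt e) (src e).
Proof.
apply/negP => /connectP[p pp lp].
have /negP := Defs.arc_acyclic (tgt e) p; apply.
by rewrite /= rcons_path pp -lp; exact: (valP e).
Qed.

Lemma eval_unreachable n act w e t x v : ~~ connect (@Defs.arc G) (tgt e) v ->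
  Defs.eval n act [eta w with e |-> t] x v = Defs.eval n act w x v.
Proof.
elim: n v => [//|n IHn] v ev /=; case: ifP => // _.
congr (act v _); rewrite !preactE; apply: eq_bigr => e' /[!inE] /eqP e'v.
rewrite IHn; last first.
  apply: contraNN ev => /connect_trans; apply.
  by rewrite -e'v; apply: connect1; exact: (valP e').
congr (_ * _) => /=; case: eqP => // e'e.
by move: ev; rewrite -e'v e'e connect0.
Qed.

(* By acyclicity, what enters the edge [e] does not depend on its weight; this is
   why the gated network is affine, and not merely polynomial, in that weight. *)
Lemma out_src act w e t x :
  out act [eta w with e |-> t] x (src e) = out act w x (src e).
Proof. exact/eval_unreachable/src_unreachable. Qed.

(** Only the term of [e] could be quadratic in [t]; it is not, because [h0] and [h1] agree at
    [src e]. *)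
Lemma preact_affine w e t (h h0 h1 : node G -> R) v :
  (forall u, h u = h0 u + t * (h1 u - h0 u)) -> h0 (src e) = h1 (src e) ->
  preact [eta w with e |-> t] h v =
  preact [eta w with e |-> 0] h0 v +
    t * (preact [eta w with e |-> 1] h1 v - preact [eta w with e |-> 0] h0 v).
Proof.
move=> hE h01; rewrite !preactE -sumrB mulr_sumr -big_split/=.
apply: eq_bigr => e' _; rewrite hE; case: eqP => [->|_]; last by ring.
rewrite h01; ring.
Qed.

Lemma out_gate_affine (a : node G -> bool) w e t x v :
  out (gate a) [eta w with e |-> t] x v =
  out (gate a) [eta w with e |-> 0] x v +
    t * (out (gate a) [eta w with e |-> 1] x v -
         out (gate a) [eta w with e |-> 0] x v).
Proof.
(* The affine interpolation between weights 0 and 1 satisfies the network recursion, gates being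
   linear, and [out_unique] identifies it with the output at [t]. *)
pose h u := out (gate a) [eta w with e |-> 0] x u +
    t * (out (gate a) [eta w with e |-> 1] x u -
         out (gate a) [eta w with e |-> 0] x u).
suff /(congr1 (@^~ v)) <- : h = out (gate a) [eta w with e |-> t] x by [].
apply: out_unique => u; rewrite (@preact_affine w e t h
  (out (gate a) [eta w with e |-> 0] x) (out (gate a) [eta w with e |-> 1] x))//.
  rewrite /h !(outE _ _ _ u) /zval /gate.
  by case: ifP => _; [ring|case: ifP => // _; case: ifP => // _; ring].
by rewrite !out_src.
Qed.

(** The slope [b_v(x)] of an affine function, read off from its values at 0 and 1. *)
Definition zslope (a : node G -> bool) w e x v : R :=
  zval (gate a) [eta w with e |-> 1] x v -
  zval (gate a) [eta w with e |-> 0] x v.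

Lemma zval_gate_affine (a : node G -> bool) w e t x v :
  zval (gate a) [eta w with e |-> t] x v =
  zval (gate a) [eta w with e |-> 0] x v + t * zslope a w e x v.
Proof.
rewrite /zslope /zval; apply: preact_affine; first exact: out_gate_affine.
by rewrite !out_src.
Qed.

Lemma net_near_affine w e x : pattern_locally_constant w x ->
  \forall t \near w e, forall v, net [eta w with e |-> t] x v =
    zval (gate (pattern w x)) [eta w with e |-> 0] x v +
    t * zslope (pattern w x) w e x v.
Proof.
case=> r r0 rP; near=> t => v.
rewrite -zval_gate_affine /net /zval out_gate// => u ui uo.
apply: rP => // e' /=; case: eqP => [->|_]; last by rewrite subrr normr0.
by rewrite distrC; near: t; apply: cvgr_dist_lt.
Unshelve. all: end_near. Qed.

Lemma with_same w e : [eta w with e |-> w e] = w :> weights R G.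
Proof. by apply/funext => e' /=; case: eqP => [->|]. Qed.

Lemma with_twice w e s t :
  [eta [eta w with e |-> s] with e |-> t] = [eta w with e |-> t]
  :> weights R G.
Proof. by apply/funext => e' /=; case: eqP. Qed.

Lemma partial_near_poly (f : weights R G -> R) w e (p : {poly R}) :
  (\forall t \near w e, f [eta w with e |-> t] = p.[t]) ->
  partial e f w = p^`().[w e].
Proof.
move=> fp; rewrite /partial derive1E (near_eq_derive _ fp) -derive1E.
by rewrite derivE.
Qed.

(** The conclusion has the form of the hypothesis, so the lemma can be iterated for second
    derivatives. *)
Lemma partial_poly (f : weights R G -> R) w e (p : {poly R}) :
  (forall t, f [eta w with e |-> t] = p.[t]) ->
  forall t, partial e f [eta w with e |-> t] = p^`().[t].
Proof.
move=> fp t; have te : [eta w with e |-> t] e = t by rewrite /= eqxx.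
rewrite (@partial_near_poly _ _ _ p) te//.
by apply: (@nearW _ (nbhs t)) => s; rewrite with_twice.
Qed.

Lemma partial_net w e x v : pattern_locally_constant w x ->
  partial e (fun w' => net w' x v) w = zslope (pattern w x) w e x v.
Proof.
move=> /(net_near_affine e) wx; set b := zslope _ _ _ _ _.
rewrite (@partial_near_poly _ _ _
  ((zval (gate (pattern w x)) [eta w with e |-> 0] x v)%:P + b%:P * 'X)).
  by rewrite derivD derivC derivM derivC derivX mul0r !add0r mulr1 hornerC.
by apply: (@filterS _ (nbhs (w e)) _ _ _ _ wx) => t ->; rewrite !hornerE mulrC.
Qed.

Lemma log_likE w x y : log_lik w x y =
  \sum_(v in outputs G) (ln (normal_peak 1) - (y v - net w x v) ^+ 2 / 2).
Proof.
have p0 v : 0 < normal_pdf (net w x v) 1 (y v).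
  by rewrite normal_pdf1E mulr_gt0 ?expR_gt0 ?normal_peak_gt0 ?oner_neq0.
(* Writing the product as one exponential reduces the logarithm to [expRK]. *)
have lnE : \prod_(v in outputs G) normal_pdf (net w x v) 1 (y v) =
    expR (\sum_(v in outputs G) (ln (normal_peak 1) - (y v - net w x v) ^+ 2 / 2)).
  rewrite expR_sum; apply: eq_bigr => v _.
  by rewrite normal_pdf1E expRD lnK// posrE normal_peak_gt0// oner_neq0.
by rewrite /log_lik lnE expRK.
Qed.

Lemma partial_log_lik w e x y : pattern_locally_constant w x ->
  partial e (fun w' => log_lik w' x y) w =
  \sum_(v in outputs G) zslope (pattern w x) w e x v * (y v - net w x v).
Proof.
move=> wx; have wxe := net_near_affine e wx.
pose z v := zval (gate (pattern w x)) [eta w with e |-> 0] x v.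
pose b v := zslope (pattern w x) w e x v.
(* The residual [y v - net v] as a polynomial in the weight of [e]; the log-likelihood is quadratic
   in it. *)
pose q v : {poly R} := (y v - z v)%:P - (b v)%:P * 'X.
have qE v t : (q v).[t] = y v - (z v + t * b v).
  by rewrite /q !hornerE; ring.
have netE v : net w x v = z v + w e * b v.
  by rewrite -[in LHS](with_same w e) (nbhs_singleton wxe).
pose p : {poly R} := \sum_(v in outputs G)
  ((ln (normal_peak 1))%:P - (2^-1)%:P * (q v * q v)).
rewrite (@partial_near_poly _ _ _ p); last first.
  apply: (@filterS _ (nbhs (w e)) _ _ _ _ wxe) => t tE; rewrite log_likE /p horner_sum.
  apply: eq_bigr => v _; rewrite tE.
  by rewrite hornerD hornerN !hornerM !hornerC qE [2^-1 * _]mulrC.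
rewrite /p raddf_sum horner_sum; apply: eq_bigr => v _ /=.
rewrite derivB derivC sub0r derivM derivC mul0r add0r derivM.
have -> : (q v)^`() = - (b v)%:P.
  by rewrite /q derivB derivC sub0r derivM derivC derivX mul0r add0r mulr1.
rewrite hornerN !hornerM hornerD !hornerM hornerN !hornerC qE netE.
by rewrite -/(b v); field.
Qed.

End SingleWeight.

(** * Square integrability over the data and computation of [kappa] *)

Section Data.
Variables (R : realType) (G : network).
Context d (T : measurableType d) (P : probability T R).
Variable X : node G -> {RV P >-> R}.
Implicit Types (e : edge G) (v : node G) (w : weights R G).

Lemma measurable_preact w (h : T -> node G -> R) v :
  (forall u, measurable_fun setT (h ^~ u)) ->
  measurable_fun setT (fun o => preact w (h o) v).
Proof.
move=> mh; under eq_fun do rewrite preactE.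
rewrite /in_edges; under eq_fun do rewrite big_mkcond/=.
by apply: measurable_sum => e; case: (e \in _) => //; exact: measurable_funM.
Qed.

Lemma measurable_eval_relu n w v :
  measurable_fun setT (fun o => Defs.eval n (@relu R G) w (sample X o) v).
Proof.
elim: n v => [|n IHn] v /=; first exact: measurable_cst.
case: (v \in inputs G); first exact: measurable_funPT.
have mz : measurable_fun setT
    (fun o => preact w (Defs.eval n (@relu R G) w (sample X o)) v).
  exact: (@measurable_preact w (fun o => Defs.eval n _ w (sample X o))).
by rewrite /relu; case: (v \in outputs G) => //; exact: measurable_maxr.
Qed.

Lemma measurable_pattern w v :
  measurable_fun setT (fun o => pattern w (sample X o) v).
Proof.
apply: measurable_fun_ltr; first exact: measurable_cst.
apply: (@measurable_preact w (fun o => out _ w (sample X o))) => u.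
exact: measurable_eval_relu.
Qed.

Hypothesis X_L2 : forall v, v \in inputs G -> (X v : T -> R) \in Lfun P 2%:E.

Lemma Lfun2_preact w (h : T -> node G -> R) v :
  (forall u, h ^~ u \in Lfun P 2%:E) ->
  (fun o => preact w (h o) v) \in Lfun P 2%:E.
Proof.
move=> h2; under eq_fun do rewrite preactE.
apply: (@Lfun2_sum _ _ _ P _ _ _ (fun e o => w e * h o (src e))) => e.
exact: (Lfun2_scale _ (h2 _)).
Qed.

(** A gate never increases the absolute value, and measurability of the pattern keeps its output
    measurable; so square integrability propagates from the inputs. *)
Lemma Lfun2_out_gate w0 w v :
  (fun o => out (gate (pattern w0 (sample X o))) w (sample X o) v)
    \in Lfun P 2%:E.
Proof.
rewrite /out; elim: #|node G| v => [|n IHn] v /=; first exact: (Lfun_cst P 0 2).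
case vi: (v \in inputs G); first exact: X_L2.
have z2 : (fun o => preact w (Defs.eval n (gate (pattern w0 (sample X o))) w
    (sample X o)) v) \in Lfun P 2%:E.
  exact: (@Lfun2_preact w (fun o => Defs.eval n _ w (sample X o))).
rewrite /gate; case: (v \in outputs G) => //; apply: (le_Lfun2 _ _ z2).
  apply: measurable_fun_ifT => //; first exact: measurable_pattern.
  by move: z2; rewrite inE => /andP[/[!inE]].
by move=> o; case: ifP => //; rewrite normr0.
Qed.

Lemma Lfun2_zval_gate w0 w v :
  (fun o => zval (gate (pattern w0 (sample X o))) w (sample X o) v)
    \in Lfun P 2%:E.
Proof.
apply: (@Lfun2_preact w (fun o => out _ w (sample X o))) => u.
exact: Lfun2_out_gate.
Qed.

Lemma Lfun2_zslope w0 w e v :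
  (fun o => zslope (pattern w0 (sample X o)) w e (sample X o) v)
    \in Lfun P 2%:E.
Proof.
have p1 : (1 <= 2%:E :> \bar R)%E by rewrite lee_fin ler1n.
have [_ LB] := Lfun_submod_closed P p1.
rewrite /zslope; under eq_fun do rewrite addrC -mulN1r.
by apply: LB; exact: Lfun2_zval_gate.
Qed.

(** Expand the square as a double sum over incoming edges and pull the expectation inside; the
    products of outputs are integrable. *)
Lemma gamma2_dataE w0 w v :
  gamma2 (R_data X (fun o => gate (pattern w0 (sample X o))) w) w v =
  fine 'E_P[(fun o =>
    zval (gate (pattern w0 (sample X o))) w (sample X o) v ^+ 2)%R].
Proof.
pose h o := h_in (out (gate (pattern w0 (sample X o))) w (sample X o)) v.
pose ww := w_in w v.
pose F (ij : 'I_#|in_edges v| * 'I_#|in_edges v|) (o : T) : R :=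
  h o ij.1 0 * h o ij.2 0.
have F1 ij : F ij \in Lfun P 1.
  apply: (@Lfun2_mul_Lfun1 _ _ _ P (fun o => h o ij.1 0) (fun o => h o ij.2 0)).
    by rewrite /h; under eq_fun do rewrite mxE; exact: Lfun2_out_gate.
  by rewrite /h; under eq_fun do rewrite mxE; exact: Lfun2_out_gate.
have zE o : zval (gate (pattern w0 (sample X o))) w (sample X o) v ^+ 2 =
    \sum_ij (ww ij.1 0 * ww ij.2 0) * F ij o.
  rewrite /zval /preact -/ww -/(h o) mxE expr2 mulr_suml.
  rewrite -(pair_bigA _ (fun i j => (ww i 0 * ww j 0) * F (i, j) o))/=.
  apply: eq_bigr => i _; rewrite mulr_sumr; apply: eq_bigr => j _.
  by rewrite /F/= !mxE; ring.
under [in RHS]eq_fun do rewrite zE.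
rewrite (fine_expectation_lincomb _ _ F1).2.
rewrite -(pair_bigA _ (fun i j => (ww i 0 * ww j 0) * fine 'E_P[F (i, j)]))/=.
rewrite /gamma2 -/ww -mulmxA mxE; apply: eq_bigr => i _.
rewrite !mxE mulr_sumr; apply: eq_bigr => j _.
rewrite !mxE -mulrA; congr (_ * _); rewrite mulrC; congr (_ * _).
congr (fine (expectation _ _)); apply/funext => o.
have -> : F (i, j) o = (h o *m (h o)^T) i j.
  by rewrite mxE big_ord1 [(h o)^T _ _]mxE.
by [].
Qed.

(** The common value to which both [kappa] and the diagonal of [fisher] are reduced. *)
Definition mean_sqr_slope w e : R :=
  \sum_(v in outputs G) fine 'E_P[
    ((fun o => zslope (pattern w (sample X o)) w e (sample X o) v) \*
     (fun o => zslope (pattern w (sample X o)) w e (sample X o) v))%R].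

Lemma expectation_sum_sqr_slope w e :
  ('E_P[(fun o => \sum_(v in outputs G)
     zslope (pattern w (sample X o)) w e (sample X o) v ^+ 2)%R] =
   (mean_sqr_slope w e)%:E)%E.
Proof.
pose b v o := zslope (pattern w (sample X o)) w e (sample X o) v.
have b1 v : b v \* b v \in Lfun P 1.
  by apply: Lfun2_mul_Lfun1; exact: Lfun2_zslope.
have [L E] := fine_expectation_lincomb (enum (outputs G)) (fun=> 1) b1.
have -> : (fun o => \sum_(v in outputs G) b v o ^+ 2) =
    (fun o => \sum_(v <- enum (outputs G)) 1 * (b v \* b v) o).
  by apply/funext => o; rewrite big_enum; apply: eq_bigr => v _; rewrite mul1r.
rewrite -[LHS]fineK ?expectation_fin_num// E big_enum.
by congr (_%:E); apply: eq_bigr => v _; rewrite mul1r.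
Qed.

Lemma kappaE w e : kappa X w e = mean_sqr_slope w e.
Proof.
pose z v o := zval (gate (pattern w (sample X o))) [eta w with e |-> 0]
  (sample X o) v.
pose b v o := zslope (pattern w (sample X o)) w e (sample X o) v.
(* The expansion of [E[(z_v + t b_v)^2]] in [t]; its second derivative [2 E[b_v^2]] cancels the
   factor one half in [kappa]. *)
pose p v : {poly R} := (fine 'E_P[(z v \* z v)%R])%:P +
  (2 * fine 'E_P[(z v \* b v)%R]) *: 'X + fine 'E_P[(b v \* b v)%R] *: 'X^2.
have pE t : gamma2_net_frozen X w [eta w with e |-> t] =
    (\sum_(v in outputs G) p v).[t].
  rewrite /gamma2_net_frozen /gamma2_net horner_sum; apply: eq_bigr => v _.
  rewrite gamma2_dataE; under eq_fun do rewrite zval_gate_affine.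
  rewrite (@fine_expectation_sqr_affine _ _ _ _ (z v) (b v)).
  - by rewrite /p !hornerD !hornerZ hornerC hornerX hornerXn; ring.
  - exact: Lfun2_zval_gate.
  - exact: Lfun2_zslope.
(* Only the point of differentiation is rewritten; the [w] that fixes the activation pattern
   stays. *)
rewrite /kappa -[X in partial _ _ X](with_same w e).
rewrite (partial_poly (partial_poly pE)).
rewrite !raddf_sum horner_sum mulr_sumr; apply: eq_bigr => v _ /=.
have -> : (p v)^`()^`() = (2 * fine 'E_P[(b v \* b v)%R])%:P.
  have d1 : (1 : {poly R})^`() = 0 := derivC 1.
  rewrite /p !derivD !derivZ derivC deriv0 derivX d1 derivXn expr1.
  rewrite derivMn derivX scaler0 !add0r.
  by rewrite -scalerMnr alg_polyC -polyCMn mulr_natl.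
by rewrite hornerC mulrA mulVf ?mul1r// pnatr_eq0.
Qed.

End Data.

(** * The Fisher diagonal as mean squared slope *)

Section Fisher.
Variables (R : realType) (G : network).
Context d (T : measurableType d) (P : probability T R).
Variables (X : node G -> {RV P >-> R}) (w : weights R G).
Hypothesis X_L2 : forall v, v \in inputs G -> (X v : T -> R) \in Lfun P 2%:E.
Hypothesis w_generic : {ae P, forall o, pattern_locally_constant w (sample X o)}.

Lemma expectation_sqr_partial_net (e : edge G) :
  ('E_P[(fun o => \sum_(v in outputs G)
     partial e (fun w' => net w' (sample X o) v) w ^+ 2)%R]
   = (mean_sqr_slope X w e)%:E)%E.
Proof.
rewrite -(expectation_sum_sqr_slope X_L2) unlock.
apply: ae_eq_ge0_integral => [x|x|].
- by rewrite lee_fin sumr_ge0// => v _; exact: sqr_ge0.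
- by rewrite lee_fin sumr_ge0// => v _; exact: sqr_ge0.
- apply: filterS w_generic => o wo; congr EFin; apply: eq_bigr => v _.
  by rewrite partial_net.
Qed.

Lemma fisherE (e : edge G) : fisher X w e e = mean_sqr_slope X w e.
Proof.
rewrite -[RHS]/(fine (mean_sqr_slope X w e)%:E) -(expectation_sum_sqr_slope X_L2).
rewrite /fisher unlock; congr fine.
apply: ae_eq_ge0_integral => [x|x|].
- by rewrite lee_fin normal_expect_ge0// => y; exact: sqr_ge0.
- by rewrite lee_fin sumr_ge0// => v _; exact: sqr_ge0.
- apply: filterS w_generic => o wo; congr EFin.
  (* The score is an affine form in the centered coordinates with zero offset, as
     [normal_expect_sqr] expects. *)
  transitivity (normal_expect (enum (outputs G)) (net w (sample X o)) (fun y =>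
      (0 + \sum_(v <- enum (outputs G))
        zslope (pattern w (sample X o)) w e (sample X o) v *
        (y v - net w (sample X o) v)) ^+ 2)).
    congr normal_expect; apply/funext => y.
    by rewrite (partial_log_lik _ _ wo) big_enum add0r.
  by rewrite normal_expect_sqr ?enum_uniq// expr0n add0r big_enum.
Qed.

End Fisher.

(** The first clause links [fisher], defined through the Gaussian score, to the expected squared
    derivatives of the outputs; being an equality of extended reals, it also asserts finiteness. *)
Theorem theorem38 (R : realType) (G : network)
    (d : measure_display) (T : measurableType d) (P : probability T R)
    (X : node G -> {RV P >-> R}) (w : weights R G)
    (X_L2 : forall v, v \in inputs G -> (X v : T -> R) \in Lfun P 2%:E)
    (w_generic : {ae P, forall o, pattern_locally_constant w (sample X o)}) :
  [/\ forall e : edge G,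
        ('E_P[(fun o => \sum_(v in outputs G)
           partial e (fun w' => net w' (sample X o) v) w ^+ 2)%R]
         = (fisher X w e e)%:E)%E,
      forall e : edge G, kappa X w e = fisher X w e e &
      forall (eta : R) (L : weights R G -> R) (e : edge G),
        diag_natural_gradient_step X eta L w e = ddp_sgd_step X eta L w e].
Proof.
have kappa_fisher e : kappa X w e = fisher X w e e.
  by rewrite (kappaE X_L2) (fisherE X_L2 w_generic).
split=> // [e|eta L e].
- by rewrite (expectation_sqr_partial_net X_L2 w_generic) (fisherE X_L2 w_generic).
- by rewrite /diag_natural_gradient_step /ddp_sgd_step kappa_fisher.
Qed.
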